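(* Let $E$ be a Banach space and let $1<q\le2$ be given. For $p\ge q$ set $\psi_p(x):=\|x\|^p$, $x\in E$. (1) $E$ is $q$-smooth if and only if the Fréchet derivative of $\psi_q$ (exists and) is globally $(q-1)$-Hölder continuous on $E$. (2) If $E$ is $q$-smooth, then for $p>q$ the Fréchet derivative of $\psi_p$ is locally $(q-1)$-Hölder continuous on $E$. Moreover, if $E$ is $q$-smooth, then for all $p\ge q$ and $x,y\in E$ we have $$\|\psi_p'(x)-\psi_p'(y)\|\le C(\|x\|+\|y\|)^{p-q}\|x-y\|^{q-1},$$ where $C$ depends only on $p$, $q$ and $E$.
   Context: For $1<q\le2$, a Banach space $E$ is $q$-smooth if its modulus of smoothness $$\rho_{\|\cdot\|}(t)=\sup\{\tfrac12(\|x+ty\|+\|x-ty\|)-1:\ \|x\|=\|y\|=1\}$$ satisfies $\rho_{\|\cdot\|}(t)\le Kt^q$ for all $t>0$, for some constant $K$. Locally $\alpha$-Hölder continuous means $\alpha$-Hölder continuous on every ball $\{\|x\|\le R\}$, with a constant that may depend on $R$. The norm of $\psi_p'(x)-\psi_p'(y)$ is the norm of $E^*$. The convention $0^0=1$ is used. *)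

(* Defs.v *)
From HB Require Import structures.
From mathcomp Require Import all_boot all_order all_algebra.
From mathcomp Require Import all_classical all_reals all_analysis.

Set Implicit Arguments.
Unset Strict Implicit.
Unset Printing Implicit Defensive.
Import Order.TTheory GRing.Theory Num.Theory.
Import numFieldNormedType.Exports.
Local Open Scope classical_set_scope.
Local Open Scope ring_scope.

(* By the triangle inequality, the set is bounded above by [`|t|]. It is empty
   only when [E] is the zero space, where [sup set0 = 0]. *)
Definition smoothness_modulus (R : realType) (E : normedModType R) (t : R) : R :=
  sup [set s | exists x y : E, [/\ `|x| = 1, `|y| = 1 &
    s = 2^-1 * (`|x + t *: y| + `|x - t *: y|) - 1]].

Definition q_smooth (R : realType) (E : normedModType R) (q : R) : Prop :=
  exists K : R, forall t : R, 0 < t -> smoothness_modulus E t <= K * t `^ q.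

Definition norm_pow (R : realType) (E : normedModType R) (p : R) (x : E) : R :=
  `|x| `^ p.

(* [sup] is a junk value for a functional unbounded on the unit ball; the norm
   is meant for elements of the dual, i.e. continuous linear [f], such as
   differences of differentials of differentiable functions. *)
Definition dual_norm (R : realType) (E : normedModType R) (f : E -> R) : R :=
  sup [set `|f x| | x in [set x : E | `|x| <= 1]].

Definition dual_holder_on (R : realType) (E : normedModType R)
    (A : set E) (alpha : R) (F : E -> E -> R) : Prop :=
  exists C : R, forall x y : E, A x -> A y ->
    dual_norm (F x \- F y) <= C * `|x - y| `^ alpha.

Definition globally_dual_holder (R : realType) (E : normedModType R)
    (alpha : R) (F : E -> E -> R) : Prop :=
  dual_holder_on [set: E] alpha F.

Definition locally_dual_holder (R : realType) (E : normedModType R)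
    (alpha : R) (F : E -> E -> R) : Prop :=
  forall r : R, dual_holder_on [set x : E | `|x| <= r] alpha F.

(* Main.v *)
Require Import Defs.
From HB Require Import structures.
From mathcomp Require Import all_boot all_order all_algebra.
From mathcomp Require Import all_classical all_reals all_analysis.
From mathcomp Require Import ring lra.

(** Write [psi x = `|x| `^ p]. Everything turns on the symmetric second
    difference [psi (x + h) + psi (x - h) - 2 * psi x].

    If [E] is [q]-smooth, then this second difference is at most
    [C * (`|x| + `|h|) `^ (p - q) * `|h| `^ q]
    ([second_difference_norm_pow]). When [`|h|] exceeds [`|x| / 2] the bound is
    the triangle inequality. Otherwise, scale to [`|x| = 1]: up to a quadratic
    error, which is at most a multiple of [`|h| `^ q] because [q <= 2],
    [t `^ p] may be replaced by its tangent at [t = 1], and what remains is [p]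
    times the second difference of the norm, which the modulus of smoothness
    controls.

    The function [psi] is convex, and a convex function whose second difference
    at [x] is [o(`|h|)] has a linear one-sided directional derivative there:
    the derivatives along [h] and [- h] cancel. This gives Frechet
    differentiability, with a differential that is a subgradient
    ([convex_differentiable]). For such a function the error of the first order
    expansion lies between [0] and the second difference, and comparing the
    expansions at [x] and [y] bounds ['d psi y z - 'd psi x z]
    ([subgradient_diff_le]); taking [`|z|] at most [`|x - y|] yields the Hoelder
    estimate ([diff_norm_pow_holder]), of which both forward implications are
    special cases.

    Conversely, for [p = q] the subgradient inequalities at [x + h] and [x - h]
    bound the second difference of [psi] by
    ['d psi (x + h) h - 'd psi (x - h) h], hence by [`|h| `^ q] up to a
    constant, and Bernoulli's inequality passes from [`|x + h| `^ q] to
    [`|x + h|] ([q_smooth_of_diff_holder]). *)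

Set Implicit Arguments.
Unset Strict Implicit.
Unset Printing Implicit Defensive.
Import Order.TTheory GRing.Theory Num.Theory.
Import numFieldNormedType.Exports.
Local Open Scope classical_set_scope.
Local Open Scope ring_scope.

(** * Scalar inequalities for real powers *)

(** Young's inequality for [v * 1] with exponents [p] and [p / (p - 1)]. *)
Lemma bernoulli_powR (R : realType) (p v : R) :
  1 < p -> 0 <= v -> 1 + p * (v - 1) <= v `^ p.
Proof.
move=> p1 v0; have p0 : 0 < p by lra.
have pB : 0 < p - 1 by lra.
have := @conjugate_powR R v 1 p (p / (p - 1)) v0 ler01 p0.
rewrite mulr1 powR1 divr_gt0// => /(_ isT).
have -> : p^-1 + (p / (p - 1))^-1 = 1 by field; lra.
move=> /(_ erefl) /(ler_wpM2l (ltW p0)).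
have -> : p * (v `^ p / p + 1 / (p / (p - 1))) = v `^ p + (p - 1).
  by field; apply/andP; split; lra.
lra.
Qed.

(** Multiplying by [u - 1] lets one inequality express that [t `^ s] is
    Lipschitz at [1] from both sides; it follows from
    [1 - u `^ r <= - (r * ln u)] and [ln v <= v - 1]. *)
Lemma powR_sub1_le (R : realType) (s u : R) : 0 <= s -> 2^-1 <= u <= 3 / 2 ->
  (u `^ s - 1) * (u - 1) <= s * (2 `^ s + 2) * (u - 1) ^+ 2.
Proof.
move=> s0 /andP[ul uu]; have u0 : 0 < u by lra.
have lnB (r : R) : 1 - u `^ r <= - (r * ln u).
  by rewrite /powR gt_eqF//; have := expR_ge1Dx (r * ln u); lra.
have lnle (v : R) : 0 < v -> ln v <= v - 1.
  by move=> v0; have := le_ln1Dx (x := v - 1); rewrite subrKC; apply; lra.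
have t0 : 0 <= 2 `^ s :> R by exact: powR_ge0.
have [u1|/ltW u1] := leP 1 u.
  have us0 : 0 < u `^ s by exact: powR_gt0.
  have us2 : u `^ s <= 2 `^ s by apply: ge0_ler_powR; rewrite ?nnegrE; lra.
  have h : u `^ s - 1 <= u `^ s * (s * (u - 1)).
    have := lnB (- s); rewrite powRN mulNr opprK => h.
    have -> : u `^ s - 1 = u `^ s * (1 - (u `^ s)^-1).
      by rewrite mulrBr mulr1 mulfV ?gt_eqF.
    rewrite ler_pM2l//; apply: le_trans h _.
    exact: ler_wpM2l (lnle _ u0).
  have h2 : u `^ s * (s * (u - 1)) <= (2 `^ s + 2) * (s * (u - 1)).
    by apply: ler_wpM2r; [apply: mulr_ge0|]; lra.
  rewrite expr2 mulrA ler_wpM2r//; lra.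
have h : 1 - u `^ s <= s * (2 * (1 - u)).
  apply: le_trans (lnB s) _; rewrite -mulrN; apply: ler_wpM2l => //.
  rewrite -lnV//; apply: le_trans (lnle _ _) _; first by rewrite invr_gt0.
  rewrite -(ler_pM2r u0) mulrBl mulVf ?gt_eqF//; nra.
have h2 : s * (2 * (1 - u)) <= s * (2 `^ s + 2) * (1 - u).
  by rewrite -mulrA; apply: ler_wpM2l => //; apply: ler_wpM2r; lra.
have -> : (u `^ s - 1) * (u - 1) = (1 - u `^ s) * (1 - u) by ring.
have -> : (u - 1) ^+ 2 = (1 - u) * (1 - u) by ring.
rewrite mulrA ler_wpM2r//; lra.
Qed.

(** The tangent of [t `^ p] at [u] passes below the graph at [t = 1], which
    bounds [u `^ p] from above; replacing its slope by the slope at [1] costs a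
    quadratic term, and no second derivative of a real power is involved. *)
Lemma powR_taylor_le (R : realType) (p u : R) : 1 < p -> 2^-1 <= u <= 3 / 2 ->
  u `^ p <= 1 + p * (u - 1)
            + p * ((p - 1) * (2 `^ (p - 1) + 2)) * (u - 1) ^+ 2.
Proof.
move=> p1 uI; have /andP[ul uu] := uI.
have u0 : 0 < u by lra.
have tangent : u `^ p - 1 <= p * u `^ (p - 1) * (u - 1).
  (* Bernoulli at [1 / u] is this inequality divided by [u `^ p]. *)
  have := @bernoulli_powR R p u^-1 p1; rewrite invr_ge0 => /(_ (ltW u0)).
  have -> : u^-1 `^ p = (u `^ p)^-1.
    by rewrite -powR_inv1 ?(ltW u0)// -powRrM mulN1r powRN.
  have up0 : 0 < u `^ p by exact: powR_gt0.
  rewrite -(ler_pM2l up0) mulfV ?gt_eqF// mulrDr mulr1.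
  have e : u `^ p = u * u `^ (p - 1) by rewrite mulr_powRB1//; lra.
  have -> : u `^ p * (p * (u^-1 - 1)) = p * u `^ (p - 1) * (1 - u).
    rewrite e; field; lra.
  lra.
have h := @powR_sub1_le R (p - 1) u; have {}h := h ltac:(lra) uI.
have h2 : p * ((u `^ (p - 1) - 1) * (u - 1)) <=
  p * ((p - 1) * (2 `^ (p - 1) + 2) * (u - 1) ^+ 2) by rewrite ler_wpM2l//; lra.
rewrite -mulrA.
have -> : u `^ p = 1 + p * (u - 1) + ((u `^ p - 1) - p * (u - 1)) by ring.
rewrite lerD2l; apply: le_trans h2.
have -> : p * ((u `^ (p - 1) - 1) * (u - 1)) =
  p * u `^ (p - 1) * (u - 1) - p * (u - 1) by ring.
lra.
Qed.

(** * Differentiability of convex functions *)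

Lemma convex_functionE (R : realType) (E : normedModType R) (f : E -> R) :
  convex_function [set: convex_lmodType E] f ->
  forall (t : R) (x y : E), 0 <= t <= 1 ->
    f (t *: x + (1 - t) *: y) <= t * f x + (1 - t) * f y.
Proof.
move=> cf t x y /andP[t0 t1].
exact: (cf (Itv01 t0 t1) x y (in_setT _) (in_setT _)).
Qed.

Lemma norm_pow_convex (R : realType) (E : normedModType R) (p : R) : 1 <= p ->
  convex_function [set: convex_lmodType E] (norm_pow p : E -> R).
Proof.
move=> p1 t x y _ _.
have n0 (z : E) : `|z| \in (`[0, +oo[%classic : set R).
  by rewrite inE/= in_itv/= normr_ge0.
apply: le_trans (convex_powR p1 t (n0 x) (n0 y)).
have t0 : 0 <= t%:num by [].
have t1 : 0 <= 1 - t%:num by rewrite subr_ge0.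
have tri : `|t%:num *: x + (1 - t%:num) *: y|
    <= t%:num * `|x| + (1 - t%:num) * `|y|.
  by rewrite (le_trans (ler_normD _ _))// !normrZ (ger0_norm t0) (ger0_norm t1).
apply: (ge0_ler_powR _ _ _ tri); rewrite ?nnegrE//; lra.
Qed.

Definition slope (R : realType) (E : normedModType R) (f : E -> R) (x : E)
  (t : R) (h : E) : R := (f (x + t *: h) - f x) / t.

(** For convex [f] the quotients are nondecreasing in [t], so that their
    infimum is their limit at [0^'+]. *)
Definition right_derivative (R : realType) (E : normedModType R) (f : E -> R)
    (x h : E) : R :=
  inf [set slope f x t h | t in [set t | 0 < t]].

Section ConvexDifferentiability.
Variables (R : realType) (E : normedModType R) (f : E -> R) (x : E).
Hypothesis cvxf : convex_function [set: convex_lmodType E] f.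
Local Notation Delta := (slope f x).
Local Notation D := (right_derivative f x).

(** The step [s * u / (s + u)] makes the point on the left a convex combination
    of the two on the right. For [k = - h] this shows that slopes along [h] are
    bounded below by opposites of slopes along [- h]. *)
Lemma slope_add (s u : R) (h k : E) : 0 < s -> 0 < u ->
  Delta (s * u / (s + u)) (h + k) <= Delta s h + Delta u k.
Proof.
move=> s0 u0; rewrite /slope.
have su : 0 < s + u by lra.
have t01 : 0 <= u / (s + u) <= 1.
  apply/andP; split; first by rewrite divr_ge0 ?ltW.
  by rewrite ler_pdivrMr// mul1r; lra.
have := convex_functionE cvxf (x + s *: h) (x + u *: k) t01.
have -> : u / (s + u) *: (x + s *: h) + (1 - u / (s + u)) *: (x + u *: k)
    = x + (s * u / (s + u)) *: (h + k).
  rewrite !scalerDr !scalerA addrACA -scalerDl subrKC scale1r.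
  by congr (_ + (_ *: _ + _ *: _)); field; lra.
set A := f (x + s *: h); set B := f (x + u *: k); set F := f _ => le.
have su0 : 0 < s * u / (s + u) by rewrite divr_gt0// mulr_gt0.
rewrite ler_pdivrMr//; apply: le_trans (lerB le (lexx _)) _.
rewrite le_eqVlt; apply/orP; left; apply/eqP; field.
by rewrite !gt_eqF.
Qed.

Lemma slope_has_lbound (h : E) :
  has_lbound [set Delta t h | t in [set t | 0 < t]].
Proof.
exists (- Delta 1 (- h)) => _ [t /= t0 <-].
have := slope_add h (- h) t0 ltr01.
by rewrite subrr {1}/slope scaler0 addr0 subrr mul0r; lra.
Qed.

Lemma right_derivative_le (t : R) (h : E) : 0 < t -> D h <= Delta t h.
Proof.
by move=> t0; apply: ge_inf; [exact: slope_has_lbound | exists t].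
Qed.

Lemma le_right_derivative (c : R) (h : E) :
  (forall t, 0 < t -> c <= Delta t h) -> c <= D h.
Proof.
move=> ch; apply: lb_le_inf; first by exists (Delta 1 h); exists 1 => //=.
by move=> _ [t /= t0 <-]; exact: ch.
Qed.

Lemma right_derivative_subadd (h k : E) : D (h + k) <= D h + D k.
Proof.
rewrite -lerBlDr; apply: le_right_derivative => s s0.
rewrite lerBlDr -lerBlDl; apply: le_right_derivative => u u0.
rewrite lerBlDl; apply: le_trans (slope_add h k s0 u0).
by apply: right_derivative_le; rewrite divr_gt0 ?mulr_gt0// addr_gt0.
Qed.

Lemma right_derivative0 : D 0 = 0.
Proof.
have sl0 t : Delta t 0 = 0 by rewrite /slope scaler0 addr0 subrr mul0r.
apply/eqP; rewrite eq_le -{1}(sl0 1) right_derivative_le//=.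
by apply: le_right_derivative => t _; rewrite sl0.
Qed.

Lemma right_derivativeZ (a : R) (h : E) : 0 < a -> D (a *: h) = a * D h.
Proof.
move=> a0.
have le b k : 0 < b -> b * D k <= D (b *: k).
  move=> b0; apply: le_right_derivative => t t0.
  have -> : Delta t (b *: k) = b * Delta (t * b) k.
    by rewrite /slope scalerA; field; rewrite !gt_eqF.
  by rewrite ler_pM2l// right_derivative_le// mulr_gt0.
apply/eqP; rewrite eq_le le// andbT.
have /(_ (a *: h)) := le a^-1.
rewrite invr_gt0 => /(_ a0); rewrite scalerA mulVf ?gt_eqF// scale1r.
by rewrite mulrC ler_pdivrMr// mulrC.
Qed.

Hypothesis smoothf : forall e : R, 0 < e ->
  \forall h \near 0, f (x + h) + f (x - h) - 2 * f x <= e * `|h|.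

(** Smoothness enters here: [Delta t h + Delta t (- h)] is the second
    difference at [t *: h] divided by [t], and so tends to [0]. *)
Lemma right_derivativeN (h : E) : D (- h) = - D h.
Proof.
apply/eqP; rewrite -addr_eq0 eq_le; apply/andP; split; last first.
  by have := right_derivative_subadd (- h) h; rewrite addNr right_derivative0.
have [->|h0] := eqVneq h 0; first by rewrite oppr0 right_derivative0 addr0.
have nh : 0 < `|h| by rewrite normr_gt0.
apply/ler_addgt0Pl => e e0; rewrite addr0.
have /nbhs_normP[d /= d0] := smoothf (divr_gt0 e0 nh).
move=> /(_ ((d / 2 / `|h|) *: h)) /=.
set t := d / 2 / `|h|.
have t0 : 0 < t by rewrite !divr_gt0.
rewrite sub0r normrN normrZ (gtr0_norm t0) divfK ?gt_eqF//.
have -> : d / 2 < d by lra.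
move=> /(_ isT) sm.
apply: le_trans (lerD (right_derivative_le _ t0) (right_derivative_le _ t0)) _.
rewrite /slope -mulrDl ler_pdivrMr// scalerN.
have e2 : e * t = e / `|h| * (d / 2) by rewrite /t; field; rewrite !gt_eqF.
rewrite e2; lra.
Qed.

Lemma right_derivative_linear : linear (D : E -> R^o).
Proof.
have addD h k : D (h + k) = D h + D k.
  apply/eqP; rewrite eq_le right_derivative_subadd/=.
  have := right_derivative_subadd (h + k) (- k).
  by rewrite addrK right_derivativeN; lra.
move=> a h k; rewrite addD; congr (_ + _).
have [a0|a0|->] := ltgtP a 0; last by rewrite !scale0r right_derivative0.
- rewrite -[a]opprK scaleNr right_derivativeN right_derivativeZ ?oppr_gt0//.
  by rewrite scaleNr.
- exact: right_derivativeZ.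
Qed.

Hypothesis boundedf : exists M : R, \forall h \near (0 : E), f (x + h) <= M.

(** The bound from above near [x] makes the directional derivative continuous,
    since [D h <= f (x + h) - f x] and [- D h = D (- h)]. The remainder is
    nonnegative, and adding the subgradient inequality along [- h] bounds it by
    the second difference. *)
Lemma convex_differentiable :
  differentiable f x /\ forall h, f x + 'd f x h <= f (x + h).
Proof.
pose L := HB.pack_for {linear E -> R} (D : E -> R)
  (GRing.isLinear.Build R E R _ (D : E -> R) right_derivative_linear).
have LE h : L h = D h by [].
have subg h : f x + L h <= f (x + h).
  have := right_derivative_le h ltr01.
  by rewrite LE /slope scale1r divr1; lra.
have cL : continuous L.
  apply: bounded_linear_continuous.
  have [M /nbhs_normP[d /= d0 fM]] := boundedf.
  exists (M - f x); split; first exact: num_real.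
  move=> r Mr /=; apply/nbhs_normP; exists d => //= h.
  rewrite /= sub0r normrN => hd.
  have b1 := fM h; rewrite /= sub0r normrN in b1; have {}b1 := b1 hd.
  have b2 := fM (- h); rewrite /= sub0r !normrN in b2; have {}b2 := b2 hd.
  have := subg h; have := subg (- h); rewrite linearN => s1 s2.
  rewrite ler_norml; apply/andP; split; lra.
have exp : f \o shift x = cst (f x) + L +o_ 0 id.
  apply/eqaddoP => e e0; near=> h.
  have -> : (f \o shift x - (cst (f x) + L)) h = f (x + h) - (f x + L h).
    by rewrite [x + h]addrC.
  rewrite ger0_norm ?subr_ge0//.
  have sm : f (x + h) + f (x - h) - 2 * f x <= e * `|h|.
    by near: h; exact: smoothf.
  by have := subg (- h); rewrite linearN/=; lra.
have dfL := diff_unique cL exp.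
split; last by move=> h; rewrite dfL.
by apply/diff_locallyP; rewrite dfL.
Unshelve. all: by end_near. Qed.

End ConvexDifferentiability.

(** The right-hand side minus [f x] dominates every difference quotient with
    step in [(0, 1]], hence their limit. *)
Lemma convex_diff_subgradient (R : realType) (E : normedModType R)
    (f : E -> R) (x h : E) :
  convex_function [set: convex_lmodType E] f -> differentiable f x ->
  f x + 'd f x h <= f (x + h).
Proof.
move=> cvxf df; rewrite -lerBrDl -deriveE//.
have := diff_derivable (v := h) df.
rewrite /derivable /derive => cv.
apply: (@cvgr_to_le _ (0 : R)^'+ _ _ _ _ _ (cvg_trans _ cv)).
  apply: cvg_app => A [e /= e0 eA]; exists e => //= t te t0.
  by apply: eA => //; rewrite gt_eqF.
near=> t.
have t0 : 0 < t by near: t; exact: nbhs_right_gt.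
have t1 : t <= 1 by near: t; exact: nbhs_right_le.
rewrite /= /GRing.scale/= mulrC ler_pdivrMr//.
have := convex_functionE cvxf (t := t) (x + h) x.
rewrite ltW// t1 => /(_ isT).
have -> : t *: (x + h) + (1 - t) *: x = t *: h + x.
  by rewrite scalerDr scalerBl scale1r addrC addrA subrK addrC.
lra.
Unshelve. all: by end_near. Qed.

(** The subgradient inequality at [y], tested at [x + z], bounds [D y z]; the
    first order expansions at [x] along [z] and at [y] along [x - y] turn the
    values of [f] into gradients, with errors at most the second differences. *)
Lemma subgradient_diff_le (R : realType) (E : normedModType R) (f : E -> R)
    (D : E -> {linear E -> R}) (w : E -> R -> R) :
  (forall x h, f x + D x h <= f (x + h)) ->
  (forall x h, f (x + h) + f (x - h) - 2 * f x <= w x `|h|) ->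
  forall x y z, D y z - D x z <= w x `|z| + w y `|x - y|.
Proof.
move=> sub wf x y z.
have h1 : f y + D y (x - y) + D y z <= f (x + z).
  have := sub y (x - y + z).
  by rewrite linearD addrA; congr (_ <= f _); rewrite addrA subrKC.
have h2 := sub x (- z); rewrite linearN in h2.
have h3 := wf x z.
have h4 := sub y (- (x - y)); rewrite linearN in h4.
have h5 := wf y (x - y); rewrite subrKC in h5.
lra.
Qed.

(** * The dual norm *)

Lemma le_dual_norm (R : realType) (E : normedModType R) (f : {linear E -> R})
  (h : E) : continuous f -> `|f h| <= dual_norm f * `|h|.
Proof.
move=> cf; have [->|h0] := eqVneq h 0.
  by rewrite linear0 !normr0 mulr0.
have nh : 0 < `|h| by rewrite normr_gt0.
have [k k0 fk] := linear_lipschitz cf.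
rewrite -ler_pdivrMr//; apply: ub_le_sup.
  exists k => _ [z /= z1 <-]; apply: le_trans (fk z) _.
  by rewrite ler_piMr// ltW.
exists (`|h|^-1 *: h) => /=.
  by rewrite normrZ normfV normr_id mulVf ?gt_eqF.
by rewrite linearZ/= normrM normfV normr_id mulrC.
Qed.

Lemma dual_norm_le (R : realType) (E : normedModType R) (f : E -> R) (M : R) :
  (forall h, `|h| <= 1 -> `|f h| <= M) -> dual_norm f <= M.
Proof.
move=> fM; apply: ge_sup; first by exists `|f 0|, 0 => //=; rewrite normr0.
by move=> _ [h /= h1 <-]; exact: fM.
Qed.

(** * Second differences of powers of the norm *)

Lemma norm_powZ (R : realType) (E : normedModType R) (p a : R) (x : E) :
  0 <= a -> norm_pow p (a *: x) = a `^ p * norm_pow p x.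
Proof. by move=> a0; rewrite /norm_pow normrZ ger0_norm// powRM. Qed.

Lemma second_difference_norm_le (R : realType) (E : normedModType R) (q : R) :
  0 < q -> q_smooth E q ->
  exists2 K : R, 0 <= K & forall x h : E, `|x| = 1 ->
    `|x + h| + `|x - h| - 2 <= K * `|h| `^ q.
Proof.
move=> q0 [K smK].
(* The constant of [q]-smoothness may be negative when [E] is trivial. *)
exists (2 * Num.max K 0).
  by rewrite mulr_ge0// le_max lexx orbT.
move=> x h x1; have [->|h0] := eqVneq h 0.
  by rewrite subr0 addr0 x1 normr0 powR0 ?gt_eqF// mulr0; lra.
have nh : 0 < `|h| by rewrite normr_gt0.
have : 2^-1 * (`|x + h| + `|x - h|) - 1 <= Num.max K 0 * `|h| `^ q.
  apply: (@le_trans _ _ (K * `|h| `^ q)); last first.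
    by rewrite ler_wpM2r ?powR_ge0// le_max lexx.
  apply: le_trans (smK _ nh); apply: ub_le_sup.
    exists `|h| => _ [y [z [y1 z1 ->]]].
    have := ler_normD y (`|h| *: z); have := ler_normB y (`|h| *: z).
    by rewrite normrZ normr_id y1 z1; lra.
  exists x, (`|h|^-1 *: h); split => //.
    by rewrite normrZ normfV normr_id mulVf ?gt_eqF.
  by rewrite scalerA mulfV ?gt_eqF// scale1r.
lra.
Qed.

(** Both [`|x + h|] and [`|x - h|] lie within [`|h|] of [1], so the quadratic
    error of the tangent is at most [`|h| ^+ 2 <= `|h| `^ q]. *)
Lemma second_difference_norm_pow_unit (R : realType) (E : normedModType R)
    (p q : R) :
  1 < q -> q <= 2 -> q <= p -> q_smooth E q ->
  exists2 C : R, 0 <= C & forall x h : E, `|x| = 1 -> `|h| <= 2^-1 ->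
    norm_pow p (x + h) + norm_pow p (x - h) - 2 <= C * `|h| `^ q.
Proof.
move=> q1 q2 qp smE; have p1 : 1 < p := lt_le_trans q1 qp.
have [K K0 nK] := second_difference_norm_le (lt_trans ltr01 q1) smE.
set T := p * ((p - 1) * (2 `^ (p - 1) + 2)).
have T0 : 0 <= T.
  have := powR_ge0 2 (p - 1) => ?.
  by apply: mulr_ge0; [|apply: mulr_ge0]; lra.
exists (p * K + 2 * T); first by rewrite addr_ge0// mulr_ge0//; lra.
move=> x h x1 h2.
have taylor (k : E) : `|k| = `|h| ->
    norm_pow p (x + k) <= 1 + p * (`|x + k| - 1) + T * `|h| `^ q.
  move=> kh.
  have nk : `| `|x + k| - 1| <= `|h|.
    by rewrite -x1 (le_trans (ler_dist_dist _ _))// addrC addKr kh.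
  have/andP[n1 n2]: 2^-1 <= `|x + k| <= 3 / 2.
    by move: nk; rewrite ler_norml => /andP[? ?]; apply/andP; split; lra.
  apply: le_trans (powR_taylor_le p1 _) _; first by rewrite n1.
  rewrite lerD2l ler_wpM2l//.
  have -> : (`|x + k| - 1) ^+ 2 = `| `|x + k| - 1| ^+ 2.
    by rewrite real_normK ?num_real.
  apply: (@le_trans _ _ (`|h| ^+ 2)); first by rewrite lerXn2r ?nnegrE.
  have [->|h0] := eqVneq h 0; first by rewrite normr0 expr0n/= powR_ge0.
  rewrite -powR_mulrn//; apply: ger_powR => //.
  by rewrite normr_gt0 h0/=; lra.
have := taylor h erefl; have := taylor (- h) (normrN h).
have : p * (`|x + h| + `|x - h| - 2) <= p * (K * `|h| `^ q).
  by apply: ler_wpM2l (nK _ _ x1); lra.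
lra.
Qed.

(** Both sides are [p]-homogeneous in [(x, h)], which reduces the case of small
    [h] to [`|x| = 1]. *)
Lemma second_difference_norm_pow (R : realType) (E : normedModType R)
    (p q : R) :
  1 < q -> q <= 2 -> q <= p -> q_smooth E q ->
  exists2 C : R, 0 <= C & forall x h : E,
  norm_pow p (x + h) + norm_pow p (x - h) - 2 * norm_pow p x
    <= C * (`|x| + `|h|) `^ (p - q) * `|h| `^ q.
Proof.
move=> q1 q2 qp smE; have p1 : 1 < p := lt_le_trans q1 qp.
have [C C0 unitC] := second_difference_norm_pow_unit q1 q2 qp smE.
exists (C + 2 * 3 `^ q); first by rewrite addr_ge0// mulr_ge0// powR_ge0.
move=> x h.
have pq0 : 0 <= p - q by lra.
have w0 : 0 <= (`|x| + `|h|) `^ (p - q) * `|h| `^ q.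
  by rewrite mulr_ge0 ?powR_ge0.
rewrite -mulrA.
(* For large [h], each term is at most [(`|x| + `|h|) `^ p], and
   [`|x| + `|h|] is at most [3 * `|h|]. *)
have [hx|xh] := leP `|h| (`|x| / 2); last first.
  apply: (@le_trans _ _ (2 * 3 `^ q * ((`|x| + `|h|) `^ (p - q) * `|h| `^ q))).
  2: by rewrite ler_wpM2r// lerDr.
  have h0 : 0 < `|h| by have := normr_ge0 x; lra.
  have np (k : E) : `|k| = `|h| -> norm_pow p (x + k) <= (`|x| + `|h|) `^ p.
    move=> kh; apply: ge0_ler_powR; rewrite ?nnegrE ?addr_ge0//; first by lra.
    by rewrite -kh ler_normD.
  have : (`|x| + `|h|) `^ p
      <= 3 `^ q * ((`|x| + `|h|) `^ (p - q) * `|h| `^ q).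
    have -> : (`|x| + `|h|) `^ p
        = (`|x| + `|h|) `^ (p - q) * (`|x| + `|h|) `^ q.
      rewrite -powRD ?subrK//; apply/implyP => _.
      by rewrite gt_eqF// ltr_wpDl.
    rewrite mulrCA -powRM// ler_wpM2l ?powR_ge0//.
    apply: ge0_ler_powR; rewrite ?nnegrE ?addr_ge0 ?mulr_ge0//; lra.
  have := np h erefl; have := np (- h) (normrN h).
  have : 0 <= norm_pow p x by exact: powR_ge0.
  rewrite -mulrA; lra.
have [x0|x0] := eqVneq x 0.
  move: hx; rewrite x0 normr0 mul0r normr_le0 => /eqP ->.
  rewrite subr0 addr0 /norm_pow normr0 powR0; last by rewrite gt_eqF//; lra.
  rewrite (@powR0 _ q); last by rewrite gt_eqF//; lra.
  by rewrite !mulr0 addr0 subr0.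
have nx : 0 < `|x| by rewrite normr_gt0.
set a := `|x|; have a0 : 0 <= a by exact: normr_ge0.
pose u := a^-1 *: x; pose k := a^-1 *: h.
have ax : x = a *: u by rewrite scalerA mulfV ?scale1r// gt_eqF.
have ah : h = a *: k by rewrite scalerA mulfV ?scale1r// gt_eqF.
have u1 : `|u| = 1 by rewrite normrZ normfV normr_id mulVf ?gt_eqF.
have nk : `|h| = a * `|k| by rewrite [in LHS]ah normrZ normr_id.
have k2 : `|k| <= 2^-1 by rewrite -(ler_pM2l nx) -nk.
have -> : norm_pow p (x + h) = a `^ p * norm_pow p (u + k).
  by rewrite {1}ax {1}ah -scalerDr norm_powZ.
have -> : norm_pow p (x - h) = a `^ p * norm_pow p (u - k).
  by rewrite {1}ax {1}ah -scalerBr norm_powZ.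
have -> : norm_pow p x = a `^ p by [].
have le1 : norm_pow p (u + k) + norm_pow p (u - k) - 2
    <= C * ((1 + `|k|) `^ (p - q) * `|k| `^ q).
  apply: le_trans (unitC _ _ u1 k2) _; rewrite ler_wpM2l// ler_peMl ?powR_ge0//.
  by rewrite -[leLHS](powRr0 (1 + `|k|)) ler_powR// lerDl.
apply: (@le_trans _ _ (C * ((a + `|h|) `^ (p - q) * `|h| `^ q))); last first.
  by rewrite ler_wpM2r// lerDl mulr_ge0 ?powR_ge0.
have -> : (a + `|h|) `^ (p - q) * `|h| `^ q
    = a `^ p * ((1 + `|k|) `^ (p - q) * `|k| `^ q).
  rewrite nk -[X in X + _]mulr1 -mulrDr !powRM// ?addr_ge0//.
  rewrite mulrACA -powRD ?subrK//; apply/implyP => _; exact: lt0r_neq0.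
have ap : 0 <= a `^ p by exact: powR_ge0.
have := ler_wpM2l ap le1; lra.
Qed.

(** * Differentials of powers of the norm *)

Lemma norm_pow_differentiable (R : realType) (E : normedModType R) (p q : R) :
  1 < q -> q <= 2 -> q <= p -> q_smooth E q -> forall x : E,
  differentiable (norm_pow p : E -> R) x /\
  forall h : E,
    norm_pow p x + 'd (norm_pow p : E -> R) x h <= norm_pow p (x + h).
Proof.
move=> q1 q2 qp smE x.
have [C C0 wC] := second_difference_norm_pow q1 q2 qp smE.
apply: convex_differentiable; first by apply: norm_pow_convex; lra.
  move=> e e0; pose B := C * (`|x| + 1) `^ (p - q) + 1.
  have B0 : 0 < B by rewrite ltr_wpDl// mulr_ge0// powR_ge0.
  have eB : 0 < e / B by rewrite divr_gt0.
  (* Below this radius, the coefficient of [`|h| `^ q] is at most [B], and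
     [B * `|h| `^ (q - 1)] is at most [e]. *)
  apply/nbhs_normP; exists (Num.min 1 ((e / B) `^ (q - 1)^-1)) => /=.
    by rewrite lt_min ltr01 powR_gt0.
  move=> h /=; rewrite sub0r normrN lt_min => /andP[h1 hd].
  apply: le_trans (wC x h) _; rewrite -[`|h| `^ q]mulr_powRB1//; last by lra.
  have l1 : C * (`|x| + `|h|) `^ (p - q) <= B.
    apply: ler_wpDr => //; apply: ler_wpM2l => //.
    apply: ge0_ler_powR; rewrite ?nnegrE ?subr_ge0 ?lerD2l ?addr_ge0//.
    exact: ltW.
  have l2 : `|h| `^ (q - 1) <= e / B.
    have -> : e / B = ((e / B) `^ (q - 1)^-1) `^ (q - 1).
      by rewrite -powRrM mulVf ?powRr1 ?ltW// gt_eqF//; lra.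
    by apply: ge0_ler_powR;
      rewrite ?nnegrE ?powR_ge0 ?subr_ge0 ?(ltW q1) ?(ltW hd).
  rewrite mulrCA [leRHS]mulrC; apply: ler_wpM2l => //.
  have -> : e = B * (e / B) by field; rewrite gt_eqF.
  by apply: ler_pM => //; rewrite ?mulr_ge0 ?powR_ge0.
exists ((`|x| + 1) `^ p); apply/nbhs_normP; exists 1 => //= h /=.
rewrite sub0r normrN => h1; apply: ge0_ler_powR; rewrite ?nnegrE ?addr_ge0//.
  by lra.
by rewrite (le_trans (ler_normD _ _))// lerD2l ltW.
Qed.

(** The increment [z = `|x - y| *: h] balances the two second differences in
    [subgradient_diff_le]; the powers of the norms combine because
    [`|x| + `|z|] and [`|y| + `|x - y|] are at most [2 * (`|x| + `|y|)]. *)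
Lemma diff_norm_pow_holder (R : realType) (E : normedModType R) (p q : R) :
  1 < q -> q <= 2 -> q <= p -> q_smooth E q ->
  exists2 C : R, 0 <= C & forall x y : E,
    dual_norm (('d (norm_pow p : E -> R) x : E -> R) \-
               ('d (norm_pow p : E -> R) y : E -> R))
      <= C * (`|x| + `|y|) `^ (p - q) * `|x - y| `^ (q - 1).
Proof.
move=> q1 q2 qp smE.
have [C C0 wC] := second_difference_norm_pow q1 q2 qp smE.
have dnp := norm_pow_differentiable q1 q2 qp smE.
pose D (x : E) : {linear E -> R} := 'd (norm_pow p : E -> R) x.
have subD (x h : E) : norm_pow p x + D x h <= norm_pow p (x + h).
  by have [_ ->] := dnp x.
pose w (x : E) (r : R) := C * (`|x| + r) `^ (p - q) * r `^ q.
have key : forall x y z, D y z - D x z <= w x `|z| + w y `|x - y|.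
  exact: subgradient_diff_le.
exists (2 * (C * 2 `^ (p - q))).
  by rewrite !mulr_ge0// powR_ge0.
move=> x y; apply: dual_norm_le => h h1 /=.
have [->|xy] := eqVneq x y.
  rewrite subrr normr0 mulr_ge0 ?powR_ge0// mulr_ge0 ?powR_ge0//.
  by rewrite !mulr_ge0// powR_ge0.
set r := `|x - y|; have r0 : 0 < r by rewrite normr_gt0 subr_eq0.
have rS : r <= `|x| + `|y| by exact: ler_normB.
set S := `|x| + `|y| in rS *.
have S0 : 0 <= S by lra.
pose M := C * 2 `^ (p - q) * S `^ (p - q) * r `^ q.
have wM (u : E) (t : R) : `|u| <= S -> 0 <= t <= r -> w u t <= M.
  move=> uS /andP[t0 tr]; rewrite /w /M -[_ * 2 `^ _ * _]mulrA -powRM//.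
  apply: ler_pM; rewrite ?powR_ge0 ?mulr_ge0 ?powR_ge0//.
    apply: ler_wpM2l => //.
    apply: ge0_ler_powR; rewrite ?nnegrE ?subr_ge0 ?addr_ge0 ?mulr_ge0//.
    by lra.
  by apply: ge0_ler_powR; rewrite ?nnegrE//; lra.
have xS : `|x| <= S by rewrite lerDl.
have yS : `|y| <= S by rewrite lerDr.
have dz (z : E) : `|z| <= r -> D y z - D x z <= 2 * M.
  move=> zr; apply: le_trans (key x y z) _.
  have := wM x `|z| xS; rewrite normr_ge0 zr => /(_ isT).
  have := wM y r yS; rewrite lexx ltW// => /(_ isT); rewrite -/r.
  lra.
have rh : `|r *: h| <= r.
  by rewrite normrZ (gtr0_norm r0) ler_piMr// ltW.
have d1 := dz _ rh.
have d2 : D x (r *: h) - D y (r *: h) <= 2 * M.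
  have := dz (- (r *: h)); rewrite normrN => /(_ rh).
  by rewrite (linearN (D x)) (linearN (D y)) opprK addrC.
have e (u : E) : D u (r *: h) = r * D u h by rewrite linearZ.
rewrite !e in d1 d2.
have -> : 2 * (C * 2 `^ (p - q)) * S `^ (p - q) * r `^ (q - 1) = 2 * M / r.
  by rewrite /M -(@mulr_powRB1 _ r q) ?(ltW r0)//; [field; rewrite gt_eqF|lra].
rewrite ler_pdivlMr// -[X in _ * X](gtr0_norm r0) -normrM ler_norml.
rewrite -[_ - _]/(D x h - D y h).
by apply/andP; split; lra.
Qed.

(** Adding the two subgradient inequalities at [x + h] and [x - h], both tested
    at [x], avoids integrating the differential along a segment. *)
Lemma q_smooth_of_diff_holder (R : realType) (E : normedModType R) (q : R) :
  1 < q -> (forall x : E, differentiable (norm_pow q : E -> R) x) ->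
  globally_dual_holder (q - 1)
    (fun x : E => 'd (norm_pow q : E -> R) x : E -> R) ->
  q_smooth E q.
Proof.
move=> q1 df [C holderC]; have q0 : 0 < q by lra.
pose D (x : E) : {linear E -> R} := 'd (norm_pow q : E -> R) x.
have subD (x h : E) : norm_pow q x + D x h <= norm_pow q (x + h).
  by apply: convex_diff_subgradient => //; apply: norm_pow_convex; lra.
(* The Hoelder constant may be negative when [E] is trivial. *)
pose K := Num.max C 0 * 2 `^ (q - 1) / (2 * q).
have C0 : 0 <= Num.max C 0 by rewrite le_max lexx orbT.
have K0 : 0 <= K.
  by apply: divr_ge0; [rewrite mulr_ge0 ?powR_ge0 | lra].
exists K => t t0; have Kt0 : 0 <= K * t `^ q by rewrite mulr_ge0 ?powR_ge0.
rewrite /smoothness_modulus; set A := [set _ | _].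
have [->|/set0P A0] := eqVneq A set0; first by rewrite sup0.
apply: ge_sup A0 _ => _ [x [y [x1 y1 ->]]].
set h := t *: y.
have nh : `|h| = t by rewrite normrZ y1 mulr1 gtr0_norm.
have b1 := bernoulli_powR q1 (normr_ge0 (x + h)).
have b2 := bernoulli_powR q1 (normr_ge0 (x - h)).
have s1 : norm_pow q (x + h) - D (x + h) h <= 1.
  have := subD (x + h) (- h).
  by rewrite addrK (linearN (D _)) [leRHS]/norm_pow x1 powR1.
have s2 : norm_pow q (x - h) + D (x - h) h <= 1.
  by have := subD (x - h) h; rewrite subrK [leRHS]/norm_pow x1 powR1.
have d : D (x + h) h - D (x - h) h <= Num.max C 0 * 2 `^ (q - 1) * t `^ q.
  have cD : continuous (D (x + h) \- D (x - h)).
    by move=> z; apply: continuousB; apply: diff_continuous; exact: df.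
  apply: le_trans (ler_norm _) _.
  apply: le_trans (le_dual_norm (f := D (x + h) \- D (x - h)) h cD) _.
  rewrite nh -(mulr_powRB1 (ltW t0) q0) [t * _]mulrC mulrA ler_pM2r//.
  apply: le_trans (holderC _ _ I I) _.
  have -> : x + h - (x - h) = 2 *: h.
    by rewrite opprB addrC addrA subrK scaler_nat.
  rewrite normrZ nh normr_nat powRM ?(ltW t0)// -mulrA ler_wpM2r//.
    by rewrite mulr_ge0 ?powR_ge0.
  by rewrite le_max lexx.
have -> : K * t `^ q = Num.max C 0 * 2 `^ (q - 1) * t `^ q / (2 * q).
  by rewrite /K mulrAC.
rewrite ler_pdivlMr ?mulr_gt0//.
rewrite /norm_pow in s1 s2; lra.
Qed.

Theorem lemma2p1 (R : realType) (E : completeNormedModType R) (q : R)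
    (hq1 : 1 < q) (hq2 : q <= 2) :
  [/\ q_smooth E q <->
        (forall x : E, differentiable (norm_pow q : E -> R) x) /\
        globally_dual_holder (q - 1)
          (fun x : E => 'd (norm_pow q : E -> R) x : E -> R),
      q_smooth E q -> forall p : R, q < p ->
        (forall x : E, differentiable (norm_pow p : E -> R) x) /\
        locally_dual_holder (q - 1)
          (fun x : E => 'd (norm_pow p : E -> R) x : E -> R)
    & q_smooth E q -> forall p : R, q <= p ->
        exists C : R, forall x y : E,
          dual_norm (('d (norm_pow p : E -> R) x : E -> R) \-
                     ('d (norm_pow p : E -> R) y : E -> R))
            <= C * (`|x| + `|y|) `^ (p - q) * `|x - y| `^ (q - 1)].
Proof.
split.
- split=> [smE|[dq holderq]]; last exact: q_smooth_of_diff_holder dq holderq.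
  split=> [x|].
    by have [] := norm_pow_differentiable hq1 hq2 (lexx q) smE x.
  have [C _ holderC] := diff_norm_pow_holder hq1 hq2 (lexx q) smE.
  exists C => x y _ _.
  by have := holderC x y; rewrite subrr powRr0 mulr1.
- move=> smE p qp; split=> [x|r].
    by have [] := norm_pow_differentiable hq1 hq2 (ltW qp) smE x.
  have [C C0 holderC] := diff_norm_pow_holder hq1 hq2 (ltW qp) smE.
  exists (C * (r + r) `^ (p - q)) => x y /= xr yr.
  apply: le_trans (holderC x y) _; rewrite ler_wpM2r ?powR_ge0//.
  rewrite ler_wpM2l//; have r0 : 0 <= r := le_trans (normr_ge0 x) xr.
  by apply: ge0_ler_powR; rewrite ?nnegrE ?subr_ge0 ?lerD ?addr_ge0// ltW.
- move=> smE p qp.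
  by have [C _ holderC] := diff_norm_pow_holder hq1 hq2 qp smE; exists C.
Qed.
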